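(* Suppose $\mathcal{A}$ is an algebra with identity $1$ over a field $\mathbb{F}$. Suppose also that, whenever $x\in\mathcal{A}$ and $x\neq 0$, there is an algebra homomorphism $h$ from $\mathcal{A}$ to $\mathbb{F}$ such that $h(x)\neq 0$. Let $S$ be the set of unital algebra homomorphisms from $\mathcal{A}$ to $\mathbb{F}$. Suppose $T$ is a linear map from $\mathcal{A}$ to $\mathcal{A}$ such that, for every $a\in\mathcal{A}$ and every $s\in S$, $s(a)=0$ implies $s(T(a))=0$. Then $T$ is left multiplication by $T(1)$, i.e. $T(a)=T(1)a$ for every $a\in\mathcal{A}$. *)

(* Defs.v *)
From mathcomp Require Import all_boot all_order all_algebra.
Set Implicit Arguments.
Unset Strict Implicit.
Unset Printing Implicit Defensive.
Import GRing.Theory.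
Local Open Scope ring_scope.

(* An algebra homomorphism is linear and multiplicative but need not preserve
   1, unlike MathComp's [lrmorphism].  [F^o] is F as an algebra over itself. *)
Definition nonunital_alg_hom (F : fieldType) (A : algType F)
  (h : {linear A -> F^o}) : Prop := {morph h : x y / x * y}.

(* Main.v *)
Require Import Defs.
From HB Require Import structures.
From mathcomp Require Import all_boot all_order all_algebra.
Import GRing.Theory.
Local Open Scope ring_scope.

(** A scalar-valued unital homomorphism [s] satisfies [s (a - s(a) 1) = 0], so
    locality of [T] gives [s (T a) = s(a) s(T 1) = s (T 1 * a)]: every unital
    [s] kills [T a - T 1 * a].  The separating homomorphisms are not assumed
    unital, but one with [h x] nonzero is automatically so, because [h x] can be
    cancelled in [h x = h x * h 1].  So no separating homomorphism is nonzero
    at [T a - T 1 * a], which must therefore vanish. *)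

Lemma nonunital_alg_hom_nonzero_unital {F : fieldType} {A : algType F}
    {h : {linear A -> F^o}} {x : A} :
  nonunital_alg_hom h -> h x != 0 -> h 1 = 1.
Proof.
move=> hM hx0; apply: (mulfI (hx0 : (h x : F) != 0)).
by rewrite mulr1 -[in RHS](mulr1 x) hM.
Qed.

(** Locality speaks only of unital homomorphisms; this bundling makes it apply
    to the separating ones. *)
Lemma nonunital_alg_hom_nonzero_lrmorphism {F : fieldType} {A : algType F}
    {h : {linear A -> F^o}} {x : A} :
  nonunital_alg_hom h -> h x != 0 ->
  exists s : {lrmorphism A -> F^o}, s =1 h.
Proof.
move=> hM hx0.
have h1 := nonunital_alg_hom_nonzero_unital hM hx0.
pose hMM := GRing.isMonoidMorphism.Build A F^o h (h1, hM).
pose s : {lrmorphism A -> F^o} :=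
  HB.pack (GRing.Linear.sort h) (GRing.Linear.class h) hMM.
by exists s.
Qed.

(** Subtracting [s(a) 1] moves [a] into the kernel of [s], where locality
    applies.  Commutativity of the field puts [T 1] on the left. *)
Lemma local_eq_mul1_at_hom {F : fieldType} {A : algType F}
    {T : {linear A -> A}} {s : {lrmorphism A -> F^o}} :
  (forall a : A, s a = 0 -> s (T a) = 0) ->
  forall a : A, s (T a) = s (T 1 * a).
Proof.
move=> sT a.
have /sT : s (a - (s a : F)%:A) = 0.
  by rewrite linearB linearZ rmorph1 /= [_ *: _]mulr1 subrr.
have -> : T (a - (s a : F)%:A) = T a - (s a : F) *: T 1.
  by rewrite linearB linearZ.
rewrite linearB linearZ /= => /eqP; rewrite subr_eq0 => /eqP ->.
by rewrite rmorphM [RHS]mulrC.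
Qed.

Theorem theorem9 (F : fieldType) (A : algType F)
  (separating : forall x : A, x != 0 ->
     exists2 h : {linear A -> F^o}, nonunital_alg_hom h & h x != 0)
  (T : {linear A -> A})
  (T_local : forall (a : A) (s : {lrmorphism A -> F^o}),
     s a = 0 -> s (T a) = 0) :
  forall a : A, T a = T 1 * a.
Proof.
move=> a; apply/eqP; rewrite -subr_eq0; apply/negPn/negP.
move=> /separating[h hM hd].
have [s sE] := nonunital_alg_hom_nonzero_lrmorphism hM hd.
move: hd; rewrite -sE linearB /=.
by rewrite (local_eq_mul1_at_hom (T_local^~ s)) subrr eqxx.
Qed.
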